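(* Let $1\le k<n\le N$ and suppose that tasks $\{k,\dots,n\}$ form a super active period of $Q(1,N)$. Let $J_k^S$ be the number produced by the backward dynamic-programming recursion (described in the context) for $(J_p^S,J_p^F)$, $p=n,n-1,\dots,k$. Then $J_k^S$ is the optimal cost of problem $Q(k,n)$.
   Context: System. Tasks $i=1,\dots,N$, indexed in order of arrival ($a_1\le\dots\le a_N$), have arrival time $a_i$, deadline $d_i=a_i+d$ and $B$ operations each ($d,B>0$ constants). The system is either OFF (rate $0$, no cost) or ON (rate $R$). Each task takes $\beta=B/R$ time. While ON, the cost per unit time is $C_B$ when a task is being served (busy) and $C_I$ when idling, $0<C_I\le C_B$. Each OFF-to-ON transition costs $C_W$. An active period (AP) is a time interval $[t_1,t_2]$, $t_1<t_2$, such that the system is woken up at $t_1$, put to sleep at $t_2$ and kept ON in between. Tasks are served in order. Problem $Q(1,N)$ (all arrival times known): choose a number $\alpha$ of APs and instants $t_{i,1}<t_{i,2}$, $i=1,\dots,\alpha$, with $t_{i,2}<t_{j,1}$ for $i<j$, to minimize $$J=\alpha C_W+\sum_{i=1}^{\alpha}\left[C_I(t_{i,2}-t_{i,1}-\tau_{i,B})+C_B\tau_{i,B}\right]$$ subject to $\int_{\max(a_j,x_{j-1})}^{x_j}r(t)\,dt=B$ and $x_j\le d_j$ for $j=1,\dots,N$, with $x_0=0$ and $r(t)=R\sum_{i=1}^{\alpha}[u(t-t_{i,1})-u(t-t_{i,2})]$. Here $x_j$ is the departure time of task $j$, $u$ is the unit step function, and $\tau_{i,B}$ is the total length of time in the $i$-th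 AP during which tasks are actually being served. $Q(k,n)$ is the same problem in which only tasks $\{k,\dots,n\}$ are present and served. Standing assumption: within any time interval of $d$ seconds the number of task arrivals does not exceed $\lfloor d/\beta\rfloor$; moreover $\lfloor d/\beta\rfloor>1$. Super active period. With $d_0=-\infty$, $a_{N+1}=\infty$, consecutive tasks $\{k,\dots,n\}$ form a super active period of $Q(1,N)$ if $d_{k-1}+C_W/C_I<a_k$, $d_n+C_W/C_I<a_{n+1}$, and $d_j+C_W/C_I\ge a_{j+1}$ for all $j\in\{k,\dots,n-1\}$. Recursion. For $p\in\{k,\dots,n\}$ let $s_p$ be defined using only tasks $\{p,\dots,n\}$: if no task of $\{p+1,\dots,n\}$ arrives in $[a_p,d_p-\beta)$, then $s_p=d_p-\beta$; otherwise, if $p+1,\dots,p+m$ are the tasks of $\{p+1,\dots,n\}$ arriving in $[a_p,d_p-\beta)$, then $s_p=d_p-\beta-\max\{0,\max_{p+1\le j\le p+m}\delta_j\}$ with $\delta_j=\beta(j-p)-(a_j-a_p)$. Start: $J_n^S=C_W+C_B\beta$, $J_n^F=C_B\beta$. For $p=n-1,n-2,\dots,k$: - $J_p^S$: let $l\in\{p+1,\dots,n\}$ be the task (if any) with $s_p+(j-p)\beta\ge a_j$ for all $j\in\{p,\dots,l-1\}$ and $s_p+(l-p)\beta<a_l$. If no such $l$ exists, $J_p^S=C_W+(n-p+1)\beta C_B$. Otherwise $$J_p^S=\min\{C_W+(l-p)\beta C_B+J_l^S,\ C_W+(l-p)\beta C_B+[a_l-s_p-(l-p)\beta]C_I+J_l^F\}.$$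 - $J_p^F$: let $l\in\{p+1,\dots,n\}$ be the task (if any) with $a_p+(j-p)\beta\ge a_j$ for all $j\in\{p,\dots,l-1\}$ and $a_p+(l-p)\beta<a_l$. If no such $l$ exists, $J_p^F=(n-p+1)\beta C_B$. Otherwise $$J_p^F=\min\{(l-p)\beta C_B+J_l^S,\ (l-p)\beta C_B+[a_l-a_p-(l-p)\beta]C_I+J_l^F\}.$$ *)

(* Defs.v *)
(* Stdlib reals with Coquelicot.  Tasks and active periods are numbered from 1,
   as natural numbers; values of the sequences outside the relevant range are
   irrelevant. *)
From Stdlib Require Import Reals List Arith ZArith ClassicalEpsilon.
From Coquelicot Require Import Coquelicot.
Open Scope R_scope.

Record system := System {
  ops : R;              (* B   *)
  rate : R;             (* R   *)
  rel_deadline : R;     (* d   *)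
  cost_wake : R;        (* C_W *)
  cost_idle : R;        (* C_I *)
  cost_busy : R         (* C_B *)
}.

(* The initial departure time is 0, so time starts at 0 and no task arrives
   earlier.  The wake-up cost is only required to be nonnegative. *)
Definition valid_system (P : system) : Prop :=
  0 < ops P /\ 0 < rate P /\ 0 < rel_deadline P /\ 0 <= cost_wake P /\
  0 < cost_idle P /\ cost_idle P <= cost_busy P.

Definition valid_arrivals (N : nat) (a : nat -> R) : Prop :=
  0 <= a 1%nat /\
  forall j : nat, (1 <= j < N)%nat -> a j <= a (j + 1)%nat.

Definition service_time (P : system) : R := ops P / rate P.

Definition deadline (P : system) (a : nat -> R) (j : nat) : R :=
  a j + rel_deadline P.

Definition arrivals_in (N : nat) (a : nat -> R) (lo hi : R) : list nat :=
  filter (fun j => if Rle_dec lo (a j) then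
                     if Rlt_dec (a j) hi then true else false
                   else false)
         (seq 1 N).

(* Intervals of length d are taken half-open; this is the weakest reading of the
   assumption, implied by the one with closed intervals. *)
Definition bounded_arrivals (P : system) (N : nat) (a : nat -> R) : Prop :=
  let cap := Int_part (rel_deadline P / service_time P) in
  (1 < cap)%Z /\
  forall t : R,
    (Z.of_nat (length (arrivals_in N a t (t + rel_deadline P))) <= cap)%Z.

(* The first two disjunctions account for d_0 = -oo and a_(N+1) = +oo. *)
Definition super_active_period (P : system) (N : nat) (a : nat -> R)
    (k n : nat) : Prop :=
  let w := cost_wake P / cost_idle P in
  (k = 1%nat \/ deadline P a (k - 1) + w < a k) /\
  (n = N \/ deadline P a n + w < a (n + 1)%nat) /\
  (forall j : nat, (k <= j < n)%nat -> deadline P a j + w >= a (j + 1)%nat).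

Record schedule := Schedule {
  num_ap : nat;
  ap_start : nat -> R;
  ap_end : nat -> R;
  departure : nat -> R
}.

Definition unit_step (t : R) : R := if Rle_dec 0 t then 1 else 0.

Definition processing_rate (P : system) (s : schedule) (t : R) : R :=
  rate P * sum_n_m (fun i => unit_step (t - ap_start s i)
                             - unit_step (t - ap_end s i)) 1 (num_ap s).

Definition service_start (a : nat -> R) (s : schedule) (j : nat) : R :=
  Rmax (a j) (departure s (j - 1)).

(* The departure times are determined by the active periods up to a delay inside
   a period where the system is OFF, which does not change the cost and can only
   make the deadline constraint harder to meet. *)
Definition feasible (P : system) (a : nat -> R) (k n : nat) (s : schedule)
  : Prop :=
  (forall i : nat, (1 <= i <= num_ap s)%nat -> ap_start s i < ap_end s i) /\
  (forall i j : nat, (1 <= i)%nat -> (i < j)%nat -> (j <= num_ap s)%nat ->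
     ap_end s i < ap_start s j) /\
  departure s (k - 1) = 0 /\
  (forall j : nat, (k <= j <= n)%nat ->
     is_RInt (processing_rate P s) (service_start a s j) (departure s j) (ops P)
     /\ departure s j <= deadline P a j).

(* Task j may be interrupted by an OFF interval, so this means that a task is
   being served only at times t inside an active period; it is used only there. *)
Definition serving (a : nat -> R) (k n : nat) (s : schedule) (t : R) : Prop :=
  exists j : nat, (k <= j <= n)%nat /\ service_start a s j <= t < departure s j.

Definition busy_time (a : nat -> R) (k n : nat) (s : schedule) (i : nat) : R :=
  RInt (fun t => if excluded_middle_informative (serving a k n s t)
                 then 1 else 0)
       (ap_start s i) (ap_end s i).

Definition cost (P : system) (a : nat -> R) (k n : nat) (s : schedule) : R :=
  INR (num_ap s) * cost_wake P
  + sum_n_m (fun i =>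
      cost_idle P * (ap_end s i - ap_start s i - busy_time a k n s i)
      + cost_busy P * busy_time a k n s i) 1 (num_ap s).

Definition is_optimal_cost (P : system) (a : nat -> R) (k n : nat) (v : R)
  : Prop :=
  (exists s : schedule, feasible P a k n s /\ cost P a k n s = v) /\
  (forall s : schedule, feasible P a k n s -> v <= cost P a k n s).

Definition delta (P : system) (a : nat -> R) (p j : nat) : R :=
  service_time P * INR (j - p) - (a j - a p).

(* Folding from 0 gives max {0, max_j delta_j}, and 0 when no task arrives in
   the window. *)
Definition latest_start (P : system) (a : nat -> R) (n p : nat) : R :=
  let b := service_time P in
  let window :=
    filter (fun j => if Rle_dec (a p) (a j) then
                       if Rlt_dec (a j) (deadline P a p - b)
                       then true else false
                     else false)
           (seq (p + 1) (n - p)) in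
  deadline P a p - b - fold_right (fun j m => Rmax (delta P a p j) m) 0 window.

(* When tasks p, p+1, ... are served back to back from time t0, the (unique)
   task l <= n that arrives only after the departure of task l-1, while every
   earlier task has arrived when its turn comes. *)
Definition first_gap (P : system) (a : nat -> R) (n p : nat) (t0 : R)
  : option nat :=
  let free j := t0 + INR (j - p) * service_time P in
  find (fun l =>
          (if Rlt_dec (free l) (a l) then true else false)
          && forallb (fun j => if Rge_dec (free j) (a j) then true else false)
                     (seq p (l - p)))%bool
       (seq (p + 1) (n - p)).

(* Common form of both recursive formulas: the cost of serving tasks p..n from
   time t0 on, after the wake-up cost if any, given tables JS and JF for later
   tasks. *)
Definition dp_value (P : system) (a : nat -> R) (n : nat) (JS JF : nat -> R)
    (p : nat) (t0 c : R) : R :=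
  let b := service_time P in
  match first_gap P a n p t0 with
  | None => c + INR (n - p + 1) * b * cost_busy P
  | Some l =>
      Rmin (c + INR (l - p) * b * cost_busy P + JS l)
           (c + INR (l - p) * b * cost_busy P
            + (a l - t0 - INR (l - p) * b) * cost_idle P + JF l)
  end.

(* [dp_table P a n m] holds the pairs (J_p^S, J_p^F) for n - m <= p <= n. *)
Fixpoint dp_table (P : system) (a : nat -> R) (n m : nat) : nat -> R * R :=
  match m with
  | O => fun _ => (cost_wake P + cost_busy P * service_time P,
                   cost_busy P * service_time P)
  | S m' =>
      let T := dp_table P a n m' in
      let JS q := fst (T q) in
      let JF q := snd (T q) in
      let p := (n - m)%nat in
      fun q =>
        if Nat.eqb q p then
          (dp_value P a n JS JF p (latest_start P a n p) (cost_wake P),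
           dp_value P a n JS JF p (a p) 0)
        else T q
  end.

Definition dp_S (P : system) (a : nat -> R) (n p : nat) : R :=
  fst (dp_table P a n (n - p) p).

(* Main.v *)
(* The total service time is the same for all feasible schedules, so only wake-ups
   and idling matter.  Let W_p(t) be the least such cost after t when the system
   is ON and starts task p at time t.  A later start (subject to the deadlines)
   never increases W_p, and W_p(t) <= C_W + W_p(s_p) because one may sleep at the
   first gap of the earlier start.  Hence sleeping while tasks are pending, or
   waking up before s_p, cannot help; comparing the actual service starts of a
   feasible schedule task by task, from the last one backwards, gives the lower
   bound.  Starting task p by s_p keeps all later deadlines because at most
   floor(d/beta) tasks arrive in any window of length d. *)
Require Import Defs.
From Stdlib Require Import Reals Lra Lia List Arith ZArith ClassicalEpsilon.
From Coquelicot Require Import Coquelicot.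
Open Scope R_scope.

(** * Families of intervals *)

(** This form is the sum in [processing_rate] without the factor [rate P]. It is applied both to
    active periods and to service intervals. *)
Definition coverage (lo hi : nat -> R) (m n : nat) (t : R) : R :=
  sum_n_m (fun i => unit_step (t - lo i) - unit_step (t - hi i)) m n.

Definition ramp (t : R) : R := Rmax 0 t.

(** A closed-form primitive of [coverage], since [ramp] is a primitive of [unit_step]. For a chain
    it measures the part of the intervals lying before [t]. *)
Definition covered_length (lo hi : nat -> R) (m n : nat) (t : R) : R :=
  sum_n_m (fun i => ramp (t - lo i) - ramp (t - hi i)) m n.

(** The inequalities are weak because consecutive service intervals may touch, unlike active
    periods. *)
Definition interval_chain (lo hi : nat -> R) (m n : nat) : Prop :=
  (forall i : nat, (m <= i <= n)%nat -> lo i <= hi i) /\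
  (forall i j : nat, (m <= i)%nat -> (i < j)%nat -> (j <= n)%nat ->
     hi i <= lo j).

Ltac split_ramp := unfold ramp, Rmax in *; repeat destruct Rle_dec; try lra.

(** * Finite sums of reals *)

Lemma sum_zero (u : nat -> R) (m n : nat) :
  (forall j : nat, (m <= j <= n)%nat -> u j = 0) -> sum_n_m u m n = 0 :> R.
Proof.
  intros H.
  rewrite (sum_n_m_ext_loc u (fun _ => @zero R_AbelianMonoid)) by exact H.
  apply (sum_n_m_const_zero (G := R_AbelianMonoid)).
Qed.

Lemma sum_n_m_nonneg (u : nat -> R) (m n : nat) :
  (forall j : nat, (m <= j <= n)%nat -> 0 <= u j) -> 0 <= sum_n_m u m n.
Proof.
  intros H. rewrite (sum_n_m_ext_loc u (fun j => Rabs (u j))).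
  - rewrite <- (sum_zero (fun _ => 0) m n) by reflexivity.
    apply sum_n_m_le. intros; apply Rabs_pos.
  - intros j Hj. symmetry. now apply Rabs_pos_eq, H.
Qed.

Lemma sum_single (u : nat -> R) (m n i : nat) :
  (m <= i <= n)%nat ->
  (forall j : nat, (m <= j <= n)%nat -> j <> i -> u j = 0) ->
  sum_n_m u m n = u i :> R.
Proof.
  induction n as [|n IH]; intros Hi H.
  - replace i with 0%nat by lia. replace m with 0%nat by lia.
    apply sum_n_n.
  - rewrite sum_n_Sm by lia. change plus with Rplus.
    destruct (Nat.eq_dec i (S n)) as [->|Hne].
    + rewrite sum_zero; [lra|]. intros j Hj; apply H; lia.
    + rewrite IH, (H (S n)); try lra; try lia.
      intros j Hj; apply H; lia.
Qed.

Lemma sum_n_m_Rplus (u v : nat -> R) (m n : nat) :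
  sum_n_m (fun i => u i + v i) m n = sum_n_m u m n + sum_n_m v m n :> R.
Proof. exact (sum_n_m_plus u v m n). Qed.

Lemma sum_n_m_Rmult (c : R) (u : nat -> R) (m n : nat) :
  sum_n_m (fun i => c * u i) m n = c * sum_n_m u m n :> R.
Proof. exact (sum_n_m_mult_l (K := R_Ring) c u m n). Qed.

Lemma sum_n_m_Rminus (u v : nat -> R) (m n : nat) :
  sum_n_m (fun i => u i - v i) m n = sum_n_m u m n - sum_n_m v m n :> R.
Proof.
  transitivity (sum_n_m (fun i => u i + (-1) * v i) m n).
  - apply (sum_n_m_ext (G := R_AbelianMonoid)). intros i.
    change (u i - v i = u i + (-1) * v i). ring.
  - rewrite sum_n_m_Rplus, sum_n_m_Rmult. ring.
Qed.

Lemma sum_n_m_exchange (u : nat -> nat -> R) (m n m' n' : nat) :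
  sum_n_m (fun i => sum_n_m (u i) m' n') m n =
  sum_n_m (fun j => sum_n_m (fun i => u i j) m n) m' n' :> R.
Proof.
  destruct (le_lt_dec m n) as [Hmn|Hmn].
  - induction Hmn as [|n Hmn IH].
    + rewrite sum_n_n. apply sum_n_m_ext. intros; now rewrite sum_n_n.
    + rewrite sum_n_Sm by lia. rewrite IH. change plus with Rplus.
      rewrite <- sum_n_m_Rplus. apply sum_n_m_ext. intros j.
      now rewrite sum_n_Sm by lia.
  - rewrite sum_n_m_zero by lia. symmetry. apply sum_zero.
    intros; now rewrite sum_n_m_zero by lia.
Qed.

Lemma sum_n_m_cons (x : R) (u : nat -> R) (m : nat) :
  sum_n_m (fun i => if Nat.eqb i 1 then x else u (i - 1)%nat) 1 (S m) =
  x + sum_n_m u 1 m :> R.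
Proof.
  rewrite sum_Sn_m by lia. change plus with Rplus. simpl Nat.eqb at 1.
  f_equal. rewrite <- sum_n_m_S. apply sum_n_m_ext_loc.
  intros j Hj. destruct (Nat.eqb_spec (S j) 1); [lia|].
  f_equal; lia.
Qed.

(** * Coverage of a chain of intervals and its integral *)

Lemma coverage_inside (lo hi : nat -> R) (m n i : nat) (t : R) :
  interval_chain lo hi m n -> (m <= i <= n)%nat -> lo i <= t < hi i ->
  coverage lo hi m n t = 1.
Proof.
  intros [H1 H2] Hi Ht. unfold coverage.
  rewrite (sum_single _ m n i Hi).
  - unfold unit_step. repeat destruct Rle_dec; lra.
  - intros j Hj Hne. pose proof (H1 j Hj).
    destruct (Nat.lt_ge_cases i j).
    + assert (hi i <= lo j) by (apply H2; lia).
      unfold unit_step. repeat destruct Rle_dec; lra.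
    + assert (hi j <= lo i) by (apply H2; lia).
      unfold unit_step. repeat destruct Rle_dec; lra.
Qed.

Lemma coverage_outside (lo hi : nat -> R) (m n : nat) (t : R) :
  interval_chain lo hi m n ->
  (forall i : nat, (m <= i <= n)%nat -> t < lo i \/ hi i <= t) ->
  coverage lo hi m n t = 0.
Proof.
  intros [H1 _] H. apply sum_zero. intros j Hj.
  pose proof (H1 j Hj). pose proof (H j Hj).
  unfold unit_step. repeat destruct Rle_dec; lra.
Qed.

(** Brings step functions and the indicator in [busy_time] to the same form, so that busy time
    becomes a difference of [covered_length] values. *)
Lemma coverage_indicator (lo hi : nat -> R) (m n : nat) (t : R) :
  interval_chain lo hi m n ->
  coverage lo hi m n t =
  if excluded_middle_informative
       (exists i : nat, (m <= i <= n)%nat /\ lo i <= t < hi i)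
  then 1 else 0.
Proof.
  intros H. destruct excluded_middle_informative as [[i [Hi Ht]]|Hno].
  - now apply (coverage_inside lo hi m n i).
  - apply coverage_outside; [assumption|]. intros i Hi.
    destruct (Rlt_le_dec t (lo i)); [now left|].
    destruct (Rle_lt_dec (hi i) t); [now right|].
    exfalso; apply Hno; now exists i.
Qed.

Lemma is_RInt_Rconst (c u v : R) : is_RInt (fun _ => c) u v (c * (v - u)).
Proof.
  replace (c * (v - u)) with ((v - u) * c) by ring.
  apply (is_RInt_const (V := R_NormedModule)).
Qed.

Lemma is_RInt_unit_step (c u v : R) :
  is_RInt (fun t => unit_step (t - c)) u v (ramp (v - c) - ramp (u - c)).
Proof.
  (* Integrating from the jump [c] leaves a constant integrand on either side. Two such integrals
     are then joined at [c]. *)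
  assert (from_c : forall w,
            is_RInt (fun t => unit_step (t - c)) c w (ramp (w - c))).
  { intros w. destruct (Rle_lt_dec c w) as [Hw|Hw].
    - apply (is_RInt_ext (fun _ => 1)).
      + intros x. rewrite Rmin_left, Rmax_right by lra. intros Hx.
        unfold unit_step. destruct Rle_dec; lra.
      + replace (ramp (w - c)) with (1 * (w - c)) by split_ramp.
        apply is_RInt_Rconst.
    - apply (is_RInt_ext (fun _ => 0)).
      + intros x. rewrite Rmin_right, Rmax_left by lra. intros Hx.
        unfold unit_step. destruct Rle_dec; lra.
      + replace (ramp (w - c)) with (0 * (w - c)) by split_ramp.
        apply is_RInt_Rconst. }
  replace (ramp (v - c) - ramp (u - c))
    with (- ramp (u - c) + ramp (v - c)) by ring.
  apply (is_RInt_Chasles (V := R_NormedModule) _ u c v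
           (- ramp (u - c)) (ramp (v - c))).
  - apply (is_RInt_swap (V := R_NormedModule)), from_c.
  - apply from_c.
Qed.

Lemma is_RInt_coverage (lo hi : nat -> R) (m n : nat) (u v : R) :
  is_RInt (coverage lo hi m n) u v
          (covered_length lo hi m n v - covered_length lo hi m n u).
Proof.
  unfold covered_length. rewrite <- sum_n_m_Rminus.
  destruct (le_lt_dec m n) as [Hmn|Hmn].
  - assert (term : forall i, is_RInt
        (fun t => unit_step (t - lo i) - unit_step (t - hi i)) u v
        (ramp (v - lo i) - ramp (v - hi i) - (ramp (u - lo i) - ramp (u - hi i)))).
    { intros i.
      replace (ramp (v - lo i) - ramp (v - hi i) - (ramp (u - lo i) - ramp (u - hi i)))
        with (minus (ramp (v - lo i) - ramp (u - lo i))
                    (ramp (v - hi i) - ramp (u - hi i)))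
        by (unfold minus, plus, opp; simpl; ring).
      apply (is_RInt_minus (V := R_NormedModule)); apply is_RInt_unit_step. }
    unfold coverage. induction Hmn as [|n Hmn IH].
    + rewrite sum_n_n.
      eapply is_RInt_ext; [|apply (term m)]. intros x _. now rewrite sum_n_n.
    + rewrite sum_n_Sm by lia.
      eapply is_RInt_ext;
        [|apply (is_RInt_plus (V := R_NormedModule) _ _ _ _ _ _ IH (term (S n)))].
      intros x _. now rewrite sum_n_Sm by lia.
  - rewrite sum_n_m_zero by lia.
    apply (is_RInt_ext (fun _ => 0)).
    + intros x _. unfold coverage. now rewrite sum_n_m_zero by lia.
    + pose proof (is_RInt_Rconst 0 u v) as H0.
      rewrite Rmult_0_l in H0. exact H0.
Qed.

Lemma covered_length_const_rate (lo hi : nat -> R) (m n : nat) (u v c : R) :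
  u <= v -> (forall t : R, u < t < v -> coverage lo hi m n t = c) ->
  covered_length lo hi m n v - covered_length lo hi m n u = c * (v - u).
Proof.
  intros Huv H.
  assert (H1 : is_RInt (coverage lo hi m n) u v (c * (v - u))).
  { apply (is_RInt_ext (fun _ => c)).
    - intros x. rewrite Rmin_left, Rmax_right by lra. intros; symmetry; auto.
    - apply is_RInt_Rconst. }
  rewrite <- (is_RInt_unique _ _ _ _ H1).
  symmetry. apply is_RInt_unique, is_RInt_coverage.
Qed.

Lemma covered_length_bounds (lo hi : nat -> R) (m n : nat) (u v : R) :
  interval_chain lo hi m n -> u <= v ->
  0 <= covered_length lo hi m n v - covered_length lo hi m n u <= v - u.
Proof.
  intros Hc Huv.
  assert (Hb : forall t, 0 <= coverage lo hi m n t <= 1).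
  { intros t. rewrite coverage_indicator by assumption.
    destruct excluded_middle_informative; lra. }
  split.
  - replace 0 with (0 * (v - u)) by ring.
    eapply is_RInt_le; [exact Huv|apply is_RInt_Rconst|apply is_RInt_coverage|].
    intros; apply Hb.
  - replace (v - u) with (1 * (v - u)) by ring.
    eapply is_RInt_le; [exact Huv|apply is_RInt_coverage|apply is_RInt_Rconst|].
    intros; apply Hb.
Qed.

(** The order of [u] and [v] is a consequence here: [feasible] uses oriented integrals and does not
    state that a departure follows the start of service. *)
Lemma covered_length_increase (lo hi : nat -> R) (m n : nat) (u v : R) :
  interval_chain lo hi m n ->
  covered_length lo hi m n u < covered_length lo hi m n v ->
  covered_length lo hi m n v - covered_length lo hi m n u <= v - u.
Proof.
  intros Hc H. destruct (Rle_lt_dec u v) as [Huv|Huv].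
  - now apply covered_length_bounds.
  - pose proof (covered_length_bounds lo hi m n v u Hc ltac:(lra)). lra.
Qed.

Lemma covered_length_le_total (lo hi : nat -> R) (m n : nat) (t : R) :
  interval_chain lo hi m n ->
  covered_length lo hi m n t <= sum_n_m (fun i => hi i - lo i) m n.
Proof.
  intros [H _].
  assert (Hs : 0 <= sum_n_m (fun i => hi i - lo i
                      - (ramp (t - lo i) - ramp (t - hi i))) m n).
  { apply sum_n_m_nonneg. intros i Hi. specialize (H i Hi). split_ramp. }
  rewrite sum_n_m_Rminus in Hs. unfold covered_length. lra.
Qed.

(* Both sides are the total length of the pairwise intersections. *)
Lemma covered_length_symmetric (lo hi lo' hi' : nat -> R) (m n m' n' : nat) :
  sum_n_m (fun i => covered_length lo' hi' m' n' (hi i)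
                    - covered_length lo' hi' m' n' (lo i)) m n =
  sum_n_m (fun j => covered_length lo hi m n (hi' j)
                    - covered_length lo hi m n (lo' j)) m' n' :> R.
Proof.
  unfold covered_length.
  transitivity (sum_n_m (fun i => sum_n_m (fun j =>
      ramp (hi i - lo' j) - ramp (hi i - hi' j)
      - (ramp (lo i - lo' j) - ramp (lo i - hi' j))) m' n') m n).
  { apply sum_n_m_ext. intros i. symmetry. apply sum_n_m_Rminus. }
  rewrite sum_n_m_exchange. apply sum_n_m_ext. intros j.
  rewrite <- sum_n_m_Rminus. apply sum_n_m_ext. intros i.
  (* This reverses every difference, exchanging the roles of the two families. The four linear terms
     that appear cancel. *)
  assert (E : forall x, ramp x = x + ramp (- x)) by (intros; split_ramp).
  rewrite (E (hi i - lo' j)), (E (hi i - hi' j)),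
    (E (lo i - lo' j)), (E (lo i - hi' j)).
  rewrite !Ropp_minus_distr.
  match goal with |- ?l = ?r => change (l = r :> R) end. ring.
Qed.

(** * Active periods and cost *)

Definition on_length (s : schedule) (t : R) : R :=
  covered_length (ap_start s) (ap_end s) 1 (num_ap s) t.

Lemma service_time_pos (P : system) : valid_system P -> 0 < service_time P.
Proof. intros (H1 & H2 & _). now apply Rdiv_lt_0_compat. Qed.

Lemma is_RInt_processing_rate (P : system) (s : schedule) (u v : R) :
  is_RInt (processing_rate P s) u v (rate P * (on_length s v - on_length s u)).
Proof. apply (is_RInt_scal (V := R_NormedModule)), is_RInt_coverage. Qed.

Lemma is_RInt_full_service (P : system) (s : schedule) (u v : R) :
  valid_system P ->
  is_RInt (processing_rate P s) u v (ops P) <->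
  on_length s v - on_length s u = service_time P.
Proof.
  intros (HB & HR & _). unfold service_time. split.
  - intros H. rewrite <- (is_RInt_unique _ _ _ _ H).
    rewrite (is_RInt_unique _ _ _ _ (is_RInt_processing_rate P s u v)).
    field. lra.
  - intros H. pose proof (is_RInt_processing_rate P s u v) as HI.
    rewrite H in HI. replace (ops P) with (rate P * (ops P / rate P)); [exact HI|].
    field. lra.
Qed.

Lemma feasible_ap_chain (P : system) (a : nat -> R) (k n : nat) (s : schedule) :
  feasible P a k n s -> interval_chain (ap_start s) (ap_end s) 1 (num_ap s).
Proof.
  intros (H1 & H2 & _). split.
  - intros i Hi. now apply Rlt_le, H1.
  - intros i j Hi Hij Hj. now apply Rlt_le, H2.
Qed.

Lemma feasible_service (P : system) (a : nat -> R) (k n : nat) (s : schedule)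
    (j : nat) :
  valid_system P -> feasible P a k n s -> (k <= j <= n)%nat ->
  on_length s (departure s j) - on_length s (service_start a s j)
  = service_time P.
Proof.
  intros HP (_ & _ & _ & H) Hj.
  apply is_RInt_full_service; [assumption|]. now apply H.
Qed.

Lemma feasible_departure (P : system) (a : nat -> R) (k n : nat)
    (s : schedule) (j : nat) :
  valid_system P -> feasible P a k n s -> (k <= j <= n)%nat ->
  service_start a s j + service_time P <= departure s j.
Proof.
  intros HP Hs Hj.
  pose proof (feasible_service P a k n s j HP Hs Hj) as H.
  pose proof (service_time_pos P HP).
  pose proof (covered_length_increase _ _ _ _
                (service_start a s j) (departure s j)
                (feasible_ap_chain P a k n s Hs)) as HI.
  unfold on_length in H. lra.
Qed.

Lemma feasible_service_chain (P : system) (a : nat -> R) (k n : nat)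
    (s : schedule) :
  valid_system P -> feasible P a k n s ->
  interval_chain (service_start a s) (departure s) k n.
Proof.
  intros HP Hs. pose proof (service_time_pos P HP).
  assert (Hle : forall i, (k <= i <= n)%nat ->
                  service_start a s i <= departure s i).
  { intros i Hi.
    pose proof (feasible_departure P a k n s i HP Hs Hi). lra. }
  split; [exact Hle|].
  intros i j Hi Hij. induction Hij as [|j Hij IH]; intros Hj.
  - unfold service_start. replace (S i - 1)%nat with i by lia. apply Rmax_r.
  - specialize (IH ltac:(lia)). specialize (Hle j ltac:(lia)).
    unfold service_start at 1. replace (S j - 1)%nat with j by lia.
    pose proof (Rmax_r (a (S j)) (departure s j)). lra.
Qed.

Lemma busy_time_covered (P : system) (a : nat -> R) (k n : nat)
    (s : schedule) (i : nat) :
  valid_system P -> feasible P a k n s ->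
  busy_time a k n s i =
  covered_length (service_start a s) (departure s) k n (ap_end s i)
  - covered_length (service_start a s) (departure s) k n (ap_start s i).
Proof.
  intros HP Hs. apply is_RInt_unique.
  eapply is_RInt_ext; [|apply is_RInt_coverage].
  intros t _. apply coverage_indicator, (feasible_service_chain P); assumption.
Qed.

(** By [covered_length_symmetric], service time summed over active periods equals ON time summed
    over service intervals, and each task contributes exactly one service time to the latter. *)
Lemma total_busy_time (P : system) (a : nat -> R) (k n : nat) (s : schedule) :
  valid_system P -> feasible P a k n s -> (k <= n)%nat ->
  sum_n_m (busy_time a k n s) 1 (num_ap s) = INR (n - k + 1) * service_time P
  :> R.
Proof.
  intros HP Hs Hkn.
  transitivity (sum_n_m (fun j => on_length s (departure s j)
                          - on_length s (service_start a s j)) k n).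
  - unfold on_length. rewrite <- covered_length_symmetric.
    apply sum_n_m_ext. intros i. now apply (busy_time_covered P).
  - rewrite (sum_n_m_ext_loc _ (fun _ => service_time P)).
    + rewrite sum_n_m_const. do 2 f_equal. lia.
    + intros j Hj. now apply (feasible_service P a k n).
Qed.

Definition on_total (s : schedule) : R :=
  sum_n_m (fun i => ap_end s i - ap_start s i) 1 (num_ap s).

Lemma cost_eq (P : system) (a : nat -> R) (k n : nat) (s : schedule) :
  valid_system P -> feasible P a k n s -> (k <= n)%nat ->
  cost P a k n s =
  INR (num_ap s) * cost_wake P
  + cost_idle P * (on_total s - INR (n - k + 1) * service_time P)
  + INR (n - k + 1) * service_time P * cost_busy P.
Proof.
  intros HP Hs Hkn. unfold cost, on_total.
  rewrite sum_n_m_Rplus, !sum_n_m_Rmult, sum_n_m_Rminus.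
  rewrite (total_busy_time P) by assumption. ring.
Qed.

(** * Deadlines *)

Lemma arrivals_monotone (N : nat) (a : nat -> R) (i j : nat) :
  valid_arrivals N a -> (1 <= i)%nat -> (i <= j)%nat -> (j <= N)%nat ->
  a i <= a j.
Proof.
  intros [_ H] Hi Hij. induction Hij as [|j Hij IH]; intros Hj; [lra|].
  specialize (IH ltac:(lia)). specialize (H j ltac:(lia)).
  rewrite Nat.add_1_r in H. lra.
Qed.

(** Tasks [i] to [j] all arrive in the half-open window of length d that starts at [a i], so their
    number is at most the floor of d divided by the service time. *)
Lemma arrivals_density (P : system) (N : nat) (a : nat -> R) (i j : nat) :
  valid_system P -> valid_arrivals N a -> bounded_arrivals P N a ->
  (1 <= i <= j)%nat -> (j <= N)%nat -> a j < a i + rel_deadline P ->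
  INR (j - i + 1) * service_time P <= rel_deadline P.
Proof.
  intros HP Ha [_ Hb] Hij HjN Haj.
  pose proof (service_time_pos P HP) as Hpos.
  specialize (Hb (a i)).
  assert (Hlen : (j - i + 1 <=
    length (arrivals_in N a (a i) (a i + rel_deadline P)))%nat).
  { rewrite <- (length_seq (j - i + 1) i) at 1.
    apply NoDup_incl_length; [apply seq_NoDup|].
    intros l Hl. apply in_seq in Hl.
    apply filter_In. split; [apply in_seq; lia|].
    pose proof (arrivals_monotone N a i l Ha ltac:(lia) ltac:(lia) ltac:(lia)).
    pose proof (arrivals_monotone N a l j Ha ltac:(lia) ltac:(lia) ltac:(lia)).
    destruct Rle_dec; [|lra]. destruct Rlt_dec; [easy|lra]. }
  assert (Hcap : INR (j - i + 1) <= rel_deadline P / service_time P).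
  { destruct (base_Int_part (rel_deadline P / service_time P)) as [Hint _].
    rewrite INR_IZR_INZ. eapply Rle_trans; [apply IZR_le|exact Hint]. lia. }
  apply (Rmult_le_compat_r (service_time P)) in Hcap; [|lra].
  unfold Rdiv in Hcap. rewrite Rmult_assoc, Rinv_l in Hcap by lra. lra.
Qed.

(** Back-to-back service from [t] with arrivals ignored. Waiting for an arrival only delays
    departures, so this is necessary for any service of [p] that begins at [t]. *)
Definition on_time (P : system) (a : nat -> R) (n p : nat) (t : R) : Prop :=
  forall j : nat, (p <= j <= n)%nat ->
    t + INR (j - p) * service_time P <= deadline P a j - service_time P.

(** A discrete intermediate value principle, used for choosing a task in [on_time_of_window] and an
    active period in [service_begin_exists]. *)
Lemma exists_crossing (Q : nat -> Prop) (p j : nat) :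
  (p <= j)%nat -> Q p -> ~ Q j ->
  exists i : nat, (p <= i < j)%nat /\ Q i /\ ~ Q (S i).
Proof.
  intros Hpj Hp. induction Hpj as [|j Hpj IH]; intros Hj; [easy|].
  destruct (excluded_middle_informative (Q j)) as [HQ|HQ].
  - exists j. split; [lia|easy].
  - destruct (IH HQ) as (i & Hi & HQi). exists i. split; [lia|easy].
Qed.

(* The standing assumption makes the tasks outside the window harmless: when the
   last task i arriving at least d before task j departs by a_j, at most d/beta
   tasks remain up to j, so that j departs by a_j + d. *)
Lemma on_time_of_window (P : system) (N : nat) (a : nat -> R) (n p : nat)
    (t : R) :
  valid_system P -> valid_arrivals N a -> bounded_arrivals P N a ->
  (1 <= p <= n)%nat -> (n <= N)%nat ->
  t <= deadline P a p - service_time P ->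
  (forall j : nat, (p < j <= n)%nat -> a j < deadline P a p - service_time P ->
     t + INR (j - p) * service_time P <= deadline P a j - service_time P) ->
  on_time P a n p t.
Proof.
  intros HP Ha Hb Hp HnN Ht Hwin j.
  induction j as [j IH] using lt_wf_ind. intros Hj.
  destruct (Nat.eq_dec j p) as [->|Hne].
  { rewrite Nat.sub_diag. simpl. lra. }
  destruct (Rlt_le_dec (a j) (deadline P a p - service_time P)) as [Hin|Hout].
  { apply Hwin; [lia|assumption]. }
  unfold deadline in *.
  destruct (Rle_lt_dec (a p) (a j - rel_deadline P)) as [Hfar|Hnear].
  (* Here [a i <= a j - d < a (S i)]. By induction task [i] departs by [a i + d <= a j], and the
     remaining [j - i] services take at most d. *)
  - destruct (exists_crossing (fun i => a i <= a j - rel_deadline P) p j)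
      as (i & Hi & Hi1 & Hi2); [lia|assumption| |].
    { destruct HP as (_ & _ & Hd & _). lra. }
    specialize (IH i ltac:(lia) ltac:(lia)).
    pose proof (arrivals_density P N a (S i) j HP Ha Hb ltac:(lia) ltac:(lia)
                  ltac:(lra)) as Hd.
    replace (j - S i + 1)%nat with (j - i)%nat in Hd by lia.
    replace (j - p)%nat with (i - p + (j - i))%nat by lia.
    rewrite plus_INR. lra.
  (* Tasks [p] to [j] arrive within less than d, so all their services fit into d. Moreover
     [t <= a j], because [j] arrives no earlier than [d_p] minus one service time. *)
  - pose proof (arrivals_density P N a p j HP Ha Hb ltac:(lia) ltac:(lia)
                  ltac:(lra)) as Hd.
    rewrite plus_INR in Hd. simpl in Hd. lra.
Qed.

Lemma fold_Rmax_le (f : nat -> R) (l : list nat) (x : R) :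
  fold_right (fun j m => Rmax (f j) m) 0 l <= x <->
  0 <= x /\ forall j : nat, In j l -> f j <= x.
Proof.
  induction l as [|i l IH]; simpl.
  - intuition.
  - split.
    + intros H. assert (Hi : f i <= x) by (eapply Rle_trans; [apply Rmax_l|exact H]).
      apply (Rle_trans _ _ _ (Rmax_r _ _)) in H.
      apply IH in H as [Hx Hl]. split; [assumption|].
      intros j [<-|Hj]; auto.
    + intros [H1 H2]. apply Rmax_lub; [auto|]. apply IH. auto.
Qed.

(** The bound on [delta P a p j] is the [on_time] inequality for [j] rearranged, and
    [on_time_of_window] supplies the tasks outside the window. Thus [latest_start] is the greatest
    punctual start, the property used from here on. *)
Lemma le_latest_start (P : system) (N : nat) (a : nat -> R) (n p : nat)
    (t : R) :
  valid_system P -> valid_arrivals N a -> bounded_arrivals P N a ->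
  (1 <= p <= n)%nat -> (n <= N)%nat ->
  t <= latest_start P a n p <-> on_time P a n p t.
Proof.
  intros HP Ha Hb Hp HnN.
  unfold latest_start. set (w := filter _ _).
  transitivity (fold_right (fun j m => Rmax (delta P a p j) m) 0 w
                <= deadline P a p - service_time P - t); [split; lra|].
  rewrite fold_Rmax_le. split.
  - intros [Ht Hw]. apply (on_time_of_window P N); try assumption; [lra|].
    intros j Hj Haj. specialize (Hw j). unfold delta, deadline in *.
    cut (In j w); [intros Hin; specialize (Hw Hin); lra|].
    apply filter_In. split; [apply in_seq; lia|].
    pose proof (arrivals_monotone N a p j Ha ltac:(lia) ltac:(lia) ltac:(lia)).
    destruct Rle_dec; [|lra]. destruct Rlt_dec; [easy|].
    unfold deadline in *; lra.
  - intros H. split.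
    + specialize (H p ltac:(lia)). rewrite Nat.sub_diag in H. simpl in H. lra.
    + intros j Hj. apply filter_In in Hj. destruct Hj as [Hj _].
      apply in_seq in Hj. specialize (H j ltac:(lia)).
      unfold delta, deadline in *. lra.
Qed.

Lemma on_time_arrival (P : system) (N : nat) (a : nat -> R) (n p : nat) :
  valid_system P -> valid_arrivals N a -> bounded_arrivals P N a ->
  (1 <= p <= n)%nat -> (n <= N)%nat ->
  on_time P a n p (a p).
Proof.
  intros HP Ha Hb Hp HnN. pose proof (service_time_pos P HP).
  assert (Hd : forall j, (p <= j <= n)%nat -> a j < a p + rel_deadline P ->
    a p + INR (j - p) * service_time P <= deadline P a j - service_time P).
  { intros j Hj Haj. unfold deadline.
    pose proof (arrivals_density P N a p j HP Ha Hb ltac:(lia) ltac:(lia) Haj)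
      as Hcap.
    pose proof (arrivals_monotone N a p j Ha ltac:(lia) ltac:(lia) ltac:(lia)).
    rewrite plus_INR in Hcap. simpl in Hcap. lra. }
  apply (on_time_of_window P N); try assumption.
  - specialize (Hd p ltac:(lia)). rewrite Nat.sub_diag in Hd. simpl in Hd.
    destruct HP as (_ & _ & Hrd & _). lra.
  - intros j Hj Haj. apply Hd; [lia|]. unfold deadline in Haj. lra.
Qed.

Lemma on_time_next (P : system) (a : nat -> R) (n p : nat) (t : R) :
  on_time P a n p t -> on_time P a n (S p) (t + service_time P).
Proof.
  intros H j Hj. specialize (H j ltac:(lia)).
  replace (j - p)%nat with (S (j - S p)) in H by lia.
  rewrite S_INR in H. lra.
Qed.

(** * The cost of gaps *)

(* W_p(t) for p = n - m: the recursion of the tables without its busy cost,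
   unfolded to one task per step. *)
Fixpoint gap_cost (P : system) (a : nat -> R) (n m p : nat) (t : R) : R :=
  match m with
  | O => 0
  | S m' =>
      let t' := t + service_time P in
      let q := S p in
      if Rle_dec (a q) t' then gap_cost P a n m' q t'
      else Rmin (cost_wake P + gap_cost P a n m' q (latest_start P a n q))
                (cost_idle P * (a q - t') + gap_cost P a n m' q (a q))
  end.

(** Task [p] may become available while the system is OFF. Then [y] is the next wake-up instant, in
    period [i]. Equality of ON lengths says that no ON time is skipped before [y]. *)
Definition service_begin (a : nat -> R) (s : schedule) (p i : nat) (y : R)
  : Prop :=
  (1 <= i <= num_ap s)%nat /\ y = Rmax (service_start a s p) (ap_start s i) /\
  y < ap_end s i /\ on_length s y = on_length s (service_start a s p).

Section Recursion.

Context (P : system) (N : nat) (a : nat -> R) (n : nat)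
  (HP : valid_system P) (Ha : valid_arrivals N a)
  (Hb : bounded_arrivals P N a) (HnN : (n <= N)%nat).

Lemma arrival_le_latest_start (p : nat) :
  (1 <= p <= n)%nat -> a p <= latest_start P a n p.
Proof.
  intros Hp. apply (le_latest_start P N); try assumption.
  now apply (on_time_arrival P N).
Qed.

Lemma next_le_latest_start (p : nat) (t : R) :
  (1 <= p < n)%nat -> t <= latest_start P a n p ->
  t + service_time P <= latest_start P a n (S p).
Proof.
  intros Hp Ht. apply (le_latest_start P N); try assumption; [lia|].
  apply on_time_next. revert Ht. apply (le_latest_start P N); try assumption.
  lia.
Qed.

(** The two claims are proved together because each inductive step uses both of them for the next
    task. *)
Lemma gap_cost_antitone_and_wake (m p : nat) :
  (p + m = n)%nat -> (1 <= p)%nat ->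
  (forall t t' : R, a p <= t -> t <= t' -> t' <= latest_start P a n p ->
     gap_cost P a n m p t' <= gap_cost P a n m p t) /\
  (forall t : R, a p <= t -> t <= latest_start P a n p ->
     gap_cost P a n m p t
     <= cost_wake P + gap_cost P a n m p (latest_start P a n p)).
Proof.
  destruct (HP) as (_ & _ & _ & HW & HI & _).
  revert p. induction m as [|m IH]; intros p Hpm Hp; simpl; [split; intros; lra|].
  destruct (IH (S p) ltac:(lia) ltac:(lia)) as [IH1 IH2].
  pose proof (arrival_le_latest_start (S p) ltac:(lia)) as Has.
  pose proof (fun t => next_le_latest_start p t ltac:(lia)) as Hnext.
  split.
  - intros t t' Ht Htt Ht'.
    specialize (Hnext t' Ht').
    repeat destruct Rle_dec; try lra.
    + apply IH1; lra.
    (* The earlier start meets a gap that the later one avoids. Its sleeping option is compared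
       through the wake-up bound, its idling option through monotonicity. *)
    + apply Rmin_glb.
      * apply IH2; lra.
      * assert (0 <= cost_idle P * (a (S p) - (t + service_time P)))
          by (apply Rmult_le_pos; lra).
        specialize (IH1 (a (S p)) (t' + service_time P)). lra.
    + apply Rmin_glb; [apply Rmin_l|].
      eapply Rle_trans; [apply Rmin_r|].
      apply Rplus_le_compat_r, Rmult_le_compat_l; lra.
  - intros t Ht Hts.
    specialize (Hnext (latest_start P a n p) ltac:(lra)).
    (* Even when [p] starts as late as possible, what remains costs at least as much as starting
       [S p] at its own latest start without a wake-up charge. *)
    assert (Hlater : gap_cost P a n m (S p) (latest_start P a n (S p)) <=
      if Rle_dec (a (S p)) (latest_start P a n p + service_time P)
      then gap_cost P a n m (S p) (latest_start P a n p + service_time P)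
      else Rmin (cost_wake P + gap_cost P a n m (S p) (latest_start P a n (S p)))
             (cost_idle P * (a (S p) - (latest_start P a n p + service_time P))
              + gap_cost P a n m (S p) (a (S p)))).
    { destruct Rle_dec; [apply IH1; lra|].
      apply Rmin_glb; [lra|].
      assert (0 <= cost_idle P
                * (a (S p) - (latest_start P a n p + service_time P)))
        by (apply Rmult_le_pos; lra).
      specialize (IH1 (a (S p)) (latest_start P a n (S p))). lra. }
    destruct (Rle_dec (a (S p)) (t + service_time P)).
    + assert (t + service_time P <= latest_start P a n (S p)) by lra.
      specialize (IH2 (t + service_time P)). lra.
    + eapply Rle_trans; [apply Rmin_l|]. lra.
Qed.

Lemma gap_cost_antitone (m p : nat) (t t' : R) :
  (p + m = n)%nat -> (1 <= p)%nat ->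
  a p <= t -> t <= t' -> t' <= latest_start P a n p ->
  gap_cost P a n m p t' <= gap_cost P a n m p t.
Proof. intros H1 H2. now apply gap_cost_antitone_and_wake. Qed.

Lemma gap_cost_le_wake (m p : nat) (t : R) :
  (p + m = n)%nat -> (1 <= p)%nat ->
  a p <= t -> t <= latest_start P a n p ->
  gap_cost P a n m p t
  <= cost_wake P + gap_cost P a n m p (latest_start P a n p).
Proof. intros H1 H2. now apply gap_cost_antitone_and_wake. Qed.

(** * Lower bound *)

Section Lower_bound.

Context (k : nat) (s : schedule) (Hk : (1 <= k)%nat)
  (Hs : feasible P a k n s).

Lemma service_begin_exists (p : nat) :
  (k <= p <= n)%nat -> exists (i : nat) (y : R), service_begin a s p i y.
Proof.
  intros Hp. pose proof (feasible_ap_chain P a k n s Hs) as Hc.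
  pose proof (service_time_pos P HP) as Hpos.
  pose proof (feasible_service P a k n s p HP Hs Hp) as Hsv.
  pose proof (feasible_departure P a k n s p HP Hs Hp) as Hdep.
  unfold on_length in Hsv.
  (* The property is vacuous at 0, so [S i] is the first period ending after the start of service.
     If there were none, no ON time would remain for serving [p]. *)
  destruct (exists_crossing (fun i => forall i', (1 <= i' <= i)%nat ->
              ap_end s i' <= service_start a s p) 0 (num_ap s))
    as (i & Hi & Hbefore & Hnot); [lia|intros; lia| |].
  { intros Hall.
    assert (H0 : covered_length (ap_start s) (ap_end s) 1 (num_ap s)
              (departure s p) -
            covered_length (ap_start s) (ap_end s) 1 (num_ap s)
              (service_start a s p) =
            0 * (departure s p - service_start a s p)); [|lra].
    apply covered_length_const_rate; [lra|]. intros t Ht.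
    apply coverage_outside; [assumption|].
    intros i Hi. specialize (Hall i Hi). right; lra. }
  assert (Hend : service_start a s p < ap_end s (S i)).
  { apply Rnot_le_lt. intros Hle. apply Hnot. intros i' Hi'.
    destruct (Nat.eq_dec i' (S i)) as [->|]; [assumption|].
    apply Hbefore; lia. }
  exists (S i), (Rmax (service_start a s p) (ap_start s (S i))).
  destruct Hs as (Hlt & Hord & _). specialize (Hlt (S i) ltac:(lia)).
  split; [lia|]. split; [reflexivity|].
  split; [now apply Rmax_lub_lt|].
  destruct (Rle_lt_dec (ap_start s (S i)) (service_start a s p)).
  { now rewrite Rmax_left. }
  rewrite Rmax_right by lra. apply Rminus_diag_uniq.
  rewrite <- (Rmult_0_l (ap_start s (S i) - service_start a s p)).
  apply covered_length_const_rate; [lra|]. intros t Ht.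
  apply coverage_outside; [assumption|]. intros i' Hi'.
  destruct (le_lt_dec i' i) as [Hle|Hgt].
  - right. specialize (Hbefore i' ltac:(lia)). lra.
  - left. destruct (Nat.eq_dec i' (S i)) as [->|]; [lra|].
    specialize (Hord (S i) i' ltac:(lia) ltac:(lia) ltac:(lia)). lra.
Qed.

Lemma service_begin_departure (p i : nat) (y : R) :
  (k <= p <= n)%nat -> service_begin a s p i y ->
  on_length s (departure s p) = on_length s y + service_time P /\
  y + service_time P <= departure s p.
Proof.
  intros Hp (_ & _ & _ & Hon).
  pose proof (service_time_pos P HP) as Hpos.
  pose proof (feasible_service P a k n s p HP Hs Hp) as Hsv.
  pose proof (covered_length_increase _ _ _ _ y (departure s p)
                (feasible_ap_chain P a k n s Hs)) as Hinc.
  unfold on_length in *. lra.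
Qed.

(** Interruptions and waiting only lengthen service, so actual departures dominate those of
    back-to-back service from [y]. Their deadlines therefore give [on_time]. *)
Lemma service_begin_window (p i : nat) (y : R) :
  (k <= p <= n)%nat -> service_begin a s p i y ->
  a p <= y <= latest_start P a n p.
Proof.
  intros Hp Hy. split.
  - destruct Hy as (_ & -> & _).
    eapply Rle_trans; [|apply Rmax_l]. apply Rmax_l.
  - apply (le_latest_start P N); try assumption; [lia|].
    assert (Hj : forall j, (p <= j)%nat -> (j <= n)%nat ->
              y + INR (j - p) * service_time P + service_time P
              <= departure s j).
    { intros j Hpj. induction Hpj as [|j Hpj IH]; intros Hj.
      - rewrite Nat.sub_diag. simpl.
        destruct (service_begin_departure p i y Hp Hy). lra.
      - specialize (IH ltac:(lia)).
        pose proof (feasible_departure P a k n s (S j) HP Hs ltac:(lia)) as Hd.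
        unfold service_start in Hd.
        replace (S j - 1)%nat with j in Hd by lia.
        pose proof (Rmax_r (a (S j)) (departure s j)).
        replace (S j - p)%nat with (S (j - p)) by lia.
        rewrite S_INR. lra. }
    intros j Hpj. specialize (Hj j ltac:(lia) ltac:(lia)).
    destruct Hs as (_ & _ & _ & Hdl).
    destruct (Hdl j ltac:(lia)) as [_ Hle]. lra.
Qed.

(** The right-hand side charges the wake-ups after period [i] and the ON time after [y] not spent
    serving tasks [p] to [n]. The induction compares where [p] and [S p] begin service. *)
Lemma gap_cost_lower_bound (m p i : nat) (y : R) :
  (p + m = n)%nat -> (k <= p)%nat -> service_begin a s p i y ->
  gap_cost P a n m p y
  <= INR (num_ap s - i) * cost_wake P
     + cost_idle P
       * (on_total s - on_length s y - INR (m + 1) * service_time P).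
Proof.
  destruct (HP) as (_ & _ & _ & HW & HI & _).
  pose proof (feasible_ap_chain P a k n s Hs) as Hc.
  pose proof (service_time_pos P HP) as Hpos.
  revert p i y. induction m as [|m IH]; intros p i y Hpm Hkp Hy;
    destruct (service_begin_departure p i y ltac:(lia) Hy) as [Hon Hdep].
  - simpl.
    pose proof (covered_length_le_total _ _ _ _ (departure s p) Hc) as Htot.
    unfold on_total, on_length in *.
    apply Rplus_le_le_0_compat.
    + apply Rmult_le_pos; [apply pos_INR|lra].
    + apply Rmult_le_pos; lra.
  - destruct (service_begin_exists (S p) ltac:(lia)) as (i' & y' & Hy').
    specialize (IH (S p) i' y' ltac:(lia) ltac:(lia) Hy').
    destruct (service_begin_window p i y ltac:(lia) Hy) as [Hay Hys].
    destruct (service_begin_window (S p) i' y' ltac:(lia) Hy') as [Hay' Hys'].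
    assert (Hss : departure s p <= service_start a s (S p)).
    { unfold service_start. replace (S p - 1)%nat with p by lia. apply Rmax_r. }
    pose proof (covered_length_bounds _ _ _ _ _ _ Hc Hss) as Hmon.
    destruct Hy as (Hi & Hyeq & Hyend & _).
    destruct Hy' as (Hi' & Hyeq' & Hyend' & Hon').
    pose proof (Rmax_l (service_start a s (S p)) (ap_start s i')) as Hssy'.
    pose proof (Rmax_r (service_start a s p) (ap_start s i)) as Hiy.
    rewrite <- Hyeq' in Hssy'. rewrite <- Hyeq in Hiy.
    fold (on_length s (service_start a s (S p))) in Hmon.
    fold (on_length s (departure s p)) in Hmon.
    assert (Hii : (i <= i')%nat).
    { apply Nat.nlt_ge. intros Hlt. destruct Hs as (_ & Hord & _).
      specialize (Hord i' i ltac:(lia) Hlt ltac:(lia)). lra. }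
    replace (S m + 1)%nat with (S (m + 1)) by lia. rewrite S_INR.
    destruct (Nat.eq_dec i i') as [<-|Hne].
    (* Same period: the system is ON from [y] to [y'], so [p] is served without interruption and any
       wait for [S p] is paid as idling. *)
    + assert (Hdeq : departure s p = y + service_time P).
      { assert (Hslope : covered_length (ap_start s) (ap_end s) 1 (num_ap s)
                    (departure s p) -
                  covered_length (ap_start s) (ap_end s) 1 (num_ap s) y
                  = 1 * (departure s p - y)).
        { apply covered_length_const_rate; [lra|]. intros t Ht.
          apply (coverage_inside _ _ _ _ i); [assumption|lia|lra]. }
        unfold on_length in Hon. lra. }
      assert (Hyss : y' = Rmax (a (S p)) (y + service_time P)).
      { rewrite Hyeq', Rmax_left by lra. unfold service_start.
        replace (S p - 1)%nat with p by lia. now rewrite Hdeq. }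
      assert (Hslope : covered_length (ap_start s) (ap_end s) 1 (num_ap s) y' -
                covered_length (ap_start s) (ap_end s) 1 (num_ap s) y
                = 1 * (y' - y)).
      { apply covered_length_const_rate; [lra|]. intros t Ht.
        apply (coverage_inside _ _ _ _ i); [assumption|lia|lra]. }
      fold (on_length s y') (on_length s y) in Hslope.
      simpl. destruct Rle_dec as [Hle|Hgt].
      * rewrite Rmax_right in Hyss by lra. rewrite <- Hyss.
        eapply Rle_trans; [exact IH|].
        apply Rplus_le_compat_l, Rmult_le_compat_l; lra.
      * rewrite Rmax_left in Hyss by lra. rewrite <- Hyss in *.
        eapply Rle_trans; [apply Rmin_r|].
        eapply Rle_trans; [apply Rplus_le_compat_l, IH|].
        apply Req_le.
        replace (on_length s y') with (on_length s y + (y' - y)) by lra. ring.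
    (* A later period: at least one more wake-up is paid. This covers replacing the rest by a fresh
       start of [S p] at its latest start, whether or not a gap follows [p]. *)
    + assert (Hlater : gap_cost P a n (S m) p y <= cost_wake P
                + gap_cost P a n m (S p) (latest_start P a n (S p))).
      { simpl. destruct Rle_dec; [|apply Rmin_l].
        apply gap_cost_le_wake; try lia; lra. }
      pose proof (gap_cost_antitone m (S p) y' (latest_start P a n (S p))
                    ltac:(lia) ltac:(lia) Hay' Hys' ltac:(lra)) as Hanti.
      assert (Hcount : INR (num_ap s - i') * cost_wake P + cost_wake P
                       <= INR (num_ap s - i) * cost_wake P).
      { assert (HS : INR (S (num_ap s - i')) <= INR (num_ap s - i))
          by (apply le_INR; lia).
        rewrite S_INR in HS.
        apply (Rmult_le_compat_r (cost_wake P)) in HS; lra. }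
      assert (cost_idle P
              * (on_total s - on_length s y' - INR (m + 1) * service_time P)
              <= cost_idle P
              * (on_total s - on_length s y - (INR (m + 1) + 1) * service_time P))
        by (apply Rmult_le_compat_l; lra).
      lra.
Qed.

(** Period [i], where [k] begins service, accounts for at least one further wake-up, and ON time
    before [y] can only add cost. *)
Lemma cost_lower_bound (m : nat) :
  (k + m = n)%nat ->
  cost_wake P + gap_cost P a n m k (latest_start P a n k)
  + INR (m + 1) * service_time P * cost_busy P <= cost P a k n s.
Proof.
  intros Hkm. destruct (HP) as (_ & _ & _ & HW & HI & _).
  destruct (service_begin_exists k ltac:(lia)) as (i & y & Hy).
  pose proof (gap_cost_lower_bound m k i y Hkm ltac:(lia) Hy) as Hlow.
  destruct (service_begin_window k i y ltac:(lia) Hy) as [Hay Hys].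
  pose proof (gap_cost_antitone m k y _ Hkm Hk Hay Hys (Rle_refl _)) as Hanti.
  rewrite (cost_eq P) by (try assumption; lia).
  replace (n - k + 1)%nat with (m + 1)%nat by lia.
  destruct Hy as (Hi & _).
  assert (Hon : 0 <= on_length s y).
  { apply sum_n_m_nonneg. intros j Hj. destruct Hs as (Hlt & _).
    specialize (Hlt j Hj). split_ramp. }
  assert (cost_idle P
          * (on_total s - on_length s y - INR (m + 1) * service_time P)
          <= cost_idle P * (on_total s - INR (m + 1) * service_time P))
    by (apply Rmult_le_compat_l; lra).
  assert (HS : INR (S (num_ap s - i)) <= INR (num_ap s))
    by (apply le_INR; lia).
  rewrite S_INR in HS. apply (Rmult_le_compat_r (cost_wake P)) in HS; lra.
Qed.

End Lower_bound.

(** * Optimal schedules *)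

Lemma on_length_before (q : nat) (s : schedule) (u : R) :
  feasible P a q n s -> u <= ap_start s 1 -> on_length s u = 0.
Proof.
  intros (Hlt & Hord & _) Hu. apply sum_zero. intros i Hi.
  pose proof (Hlt i Hi). pose proof (Hlt 1%nat ltac:(lia)).
  assert (ap_start s 1 <= ap_start s i).
  { destruct (Nat.eq_dec i 1) as [->|]; [lra|].
    specialize (Hord 1%nat i ltac:(lia) ltac:(lia) ltac:(lia)). lra. }
  split_ramp.
Qed.

(** The value 0 below [p] provides the initial departure time that [feasible] requires at index
    [p - 1]. *)
Definition departure_from (p : nat) (x : R) (f : nat -> R) (j : nat) : R :=
  if Nat.ltb j p then 0 else if Nat.eqb j p then x else f j.

(** Common to both ways of putting task [p] in front: a separate period ending at [r], or an
    extension of the first period whose old start is [r]. The added ON time precedes that old start,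
    so later departures stay valid. *)
Lemma feasible_cons (p : nat) (s s' : schedule) (t r : R) :
  (1 <= p < n)%nat -> feasible P a (S p) n s ->
  (forall i : nat, (1 <= i <= num_ap s')%nat -> ap_start s' i < ap_end s' i) ->
  (forall i j : nat, (1 <= i)%nat -> (i < j)%nat -> (j <= num_ap s')%nat ->
     ap_end s' i < ap_start s' j) ->
  (forall u : R,
     on_length s' u = on_length s u + (ramp (u - t) - ramp (u - r))) ->
  (forall j : nat, departure s' j
     = departure_from p (t + service_time P) (departure s) j) ->
  0 <= a p -> a p <= t -> t + service_time P <= deadline P a p ->
  t + service_time P <= r ->
  r <= Rmax (a (S p)) (t + service_time P) <= ap_start s 1 ->
  feasible P a p n s'.
Proof.
  intros Hp Hs Hlt' Hord' Hon Hdep Hap0 Hap Hdl Hr Hmax.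
  pose proof (service_time_pos P HP) as Hpos.
  pose proof (arrivals_monotone N a p (S p) Ha ltac:(lia) ltac:(lia) ltac:(lia))
    as Hmono.
  pose proof (Rmax_l (a (S p)) (t + service_time P)) as Hmaxl.
  pose proof (feasible_ap_chain P a (S p) n s Hs) as Hc.
  assert (Hzero : forall u, u <= ap_start s 1 -> on_length s u = 0)
    by (intros; now apply (on_length_before (S p))).
  assert (Hafter : forall j, (S p <= j <= n)%nat -> ap_start s 1 <= departure s j).
  { intros j Hj. apply Rnot_lt_le. intros Hlt.
    pose proof (feasible_service P a (S p) n s j HP Hs Hj) as Hsv.
    rewrite (Hzero (departure s j)) in Hsv by lra.
    assert (0 <= on_length s (service_start a s j)); [|lra].
    apply sum_n_m_nonneg. intros i Hi. destruct Hs as (Hlt0 & _).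
    specialize (Hlt0 i Hi). split_ramp. }
  assert (Hdep_at : departure s' p = t + service_time P).
  { rewrite Hdep. unfold departure_from.
    now rewrite Nat.ltb_irrefl, Nat.eqb_refl. }
  assert (Hdep_after : forall j, (p < j)%nat -> departure s' j = departure s j).
  { intros j Hj. rewrite Hdep. unfold departure_from.
    destruct (Nat.ltb_spec j p), (Nat.eqb_spec j p); lia || easy. }
  assert (Hdep_before : departure s' (p - 1) = 0).
  { rewrite Hdep. unfold departure_from.
    destruct (Nat.ltb_spec (p - 1) p); lia || easy. }
  split; [assumption|]. split; [assumption|]. split; [assumption|].
  intros j Hj. rewrite is_RInt_full_service by assumption.
  destruct (Nat.eq_dec j p) as [->|Hjp].
  { split; [|lra].
    unfold service_start. rewrite Hdep_at, Hdep_before, Rmax_left by lra.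
    rewrite !Hon, !Hzero by lra. split_ramp. }
  rewrite Hdep_after by lia.
  pose proof (Hafter j ltac:(lia)) as Hxj.
  pose proof (feasible_service P a (S p) n s j HP Hs ltac:(lia)) as Hsv.
  split; [|destruct Hs as (_ & _ & _ & Hs); apply Hs; lia].
  rewrite (Hon (departure s j)).
  destruct (Nat.eq_dec j (S p)) as [->|Hjp'].
  (* Only task [S p] gets a new predecessor departure: its service start moves from [a (S p)] to the
     maximum. [on_length s] vanishes at both points, and the added interval is over by the
     maximum. *)
  - unfold service_start in Hsv |- *.
    destruct Hs as (_ & _ & H0 & _). rewrite H0, Rmax_left in Hsv by lra.
    replace (S p - 1)%nat with p by lia. rewrite Hdep_at.
    rewrite Hon, (Hzero (Rmax _ _)) by apply Hmax.
    rewrite (Hzero (a (S p))) in Hsv by lra.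
    revert Hmax. generalize (Rmax (a (S p)) (t + service_time P)).
    intros x Hmax. split_ramp.
  - unfold service_start in Hsv |- *. rewrite Hdep_after by lia.
    specialize (Hafter (j - 1)%nat ltac:(lia)).
    rewrite Hon.
    pose proof (Rmax_r (a j) (departure s (j - 1))) as Hss.
    revert Hsv Hss. generalize (Rmax (a j) (departure s (j - 1))).
    intros x Hsv Hss. split_ramp.
Qed.

Definition cons_fun (x : R) (f : nat -> R) (i : nat) : R :=
  if Nat.eqb i 1 then x else f (i - 1)%nat.

Definition wake_before (p : nat) (t : R) (s : schedule) : schedule :=
  Schedule (S (num_ap s)) (cons_fun t (ap_start s))
    (cons_fun (t + service_time P) (ap_end s))
    (departure_from p (t + service_time P) (departure s)).

Definition start_earlier (p : nat) (t : R) (s : schedule) : schedule :=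
  Schedule (num_ap s) (fun i => if Nat.eqb i 1 then t else ap_start s i)
    (ap_end s) (departure_from p (t + service_time P) (departure s)).

(** The summand [F] is kept general: it is used with ramps for [on_length] and with the difference
    of endpoints for [on_total]. *)
Lemma sum_wake_before (F : R -> R -> R) (p : nat) (t : R) (s : schedule) :
  sum_n_m (fun i => F (ap_start (wake_before p t s) i)
                      (ap_end (wake_before p t s) i))
          1 (num_ap (wake_before p t s)) =
  F t (t + service_time P)
  + sum_n_m (fun i => F (ap_start s i) (ap_end s i)) 1 (num_ap s) :> R.
Proof.
  simpl num_ap. rewrite <- sum_n_m_cons. apply sum_n_m_ext. intros i.
  simpl. unfold cons_fun. now destruct Nat.eqb.
Qed.

Lemma sum_start_earlier (F : R -> R -> R) (p : nat) (t : R) (s : schedule) :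
  (1 <= num_ap s)%nat ->
  sum_n_m (fun i => F (ap_start (start_earlier p t s) i)
                      (ap_end (start_earlier p t s) i))
          1 (num_ap (start_earlier p t s)) =
  F t (ap_end s 1) - F (ap_start s 1) (ap_end s 1)
  + sum_n_m (fun i => F (ap_start s i) (ap_end s i)) 1 (num_ap s) :> R.
Proof.
  intros H. simpl num_ap.
  rewrite !(sum_Sn_m _ 1 (num_ap s)) by assumption.
  change plus with Rplus. simpl.
  rewrite (sum_n_m_ext_loc _ (fun i => F (ap_start s i) (ap_end s i))).
  - match goal with |- ?l = ?r => change (l = r :> R) end. ring.
  - intros i Hi. now destruct (Nat.eqb_spec i 1); [lia|].
Qed.

Lemma feasible_wake_before (p : nat) (t : R) (s : schedule) :
  (1 <= p < n)%nat -> feasible P a (S p) n s ->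
  0 <= a p -> a p <= t -> t + service_time P <= deadline P a p ->
  t + service_time P < a (S p) <= ap_start s 1 ->
  feasible P a p n (wake_before p t s).
Proof.
  intros Hp Hs Ha0 Hat Hdl Hnext.
  pose proof (service_time_pos P HP) as Hpos.
  pose proof (Hs) as (Hlt & Hord & _).
  apply feasible_cons with s t (t + service_time P); try easy; try lra.
  - intros i Hi. simpl in *. unfold cons_fun.
    destruct (Nat.eqb_spec i 1); [lra|]. apply Hlt. lia.
  - intros i j Hi Hij Hj. simpl in *. unfold cons_fun.
    destruct (Nat.eqb_spec j 1); [lia|].
    destruct (Nat.eqb_spec i 1); [|apply Hord; lia].
    destruct (Nat.eq_dec (j - 1) 1) as [->|]; [lra|].
    specialize (Hlt 1%nat ltac:(lia)).
    specialize (Hord 1%nat (j - 1)%nat ltac:(lia) ltac:(lia) ltac:(lia)). lra.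
  - intros u. rewrite Rplus_comm.
    apply (sum_wake_before (fun x y => ramp (u - x) - ramp (u - y))).
  - rewrite Rmax_left; lra.
Qed.

Lemma feasible_start_earlier (p : nat) (t : R) (s : schedule) :
  (1 <= p < n)%nat -> feasible P a (S p) n s -> (1 <= num_ap s)%nat ->
  0 <= a p -> a p <= t -> t + service_time P <= deadline P a p ->
  Rmax (a (S p)) (t + service_time P) = ap_start s 1 ->
  feasible P a p n (start_earlier p t s).
Proof.
  intros Hp Hs Hnum Ha0 Hat Hdl Hnext.
  pose proof (service_time_pos P HP) as Hpos.
  pose proof (Rmax_r (a (S p)) (t + service_time P)) as Hmax.
  pose proof (Hs) as (Hlt & Hord & _).
  apply feasible_cons with s t (ap_start s 1); try easy; try lra.
  - intros i Hi. simpl in *. specialize (Hlt i Hi).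
    destruct (Nat.eqb_spec i 1) as [->|]; lra.
  - intros i j Hi Hij Hj. simpl in *.
    destruct (Nat.eqb_spec j 1); [lia|]. apply Hord; lia.
  - intros u. rewrite Rplus_comm. unfold on_length, covered_length.
    rewrite (sum_start_earlier (fun x y => ramp (u - x) - ramp (u - y)))
      by assumption. ring.
Qed.

Lemma feasible_last (t : R) :
  (1 <= n)%nat -> 0 <= a n -> a n <= t ->
  t + service_time P <= deadline P a n ->
  feasible P a n n (Schedule 1 (fun _ => t) (fun _ => t + service_time P)
                      (departure_from n (t + service_time P) (fun _ => 0))).
Proof.
  intros Hn Ha0 Hat Hdl. pose proof (service_time_pos P HP) as Hpos.
  split; [intros; simpl; lra|]. split; [simpl; intros; lia|].
  assert (H0 : departure_from n (t + service_time P) (fun _ => 0) (n - 1) = 0).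
  { unfold departure_from. destruct (Nat.ltb_spec (n - 1) n); lia || easy. }
  split; [exact H0|].
  intros j Hj. replace j with n by lia.
  rewrite is_RInt_full_service by assumption.
  unfold service_start. simpl departure. rewrite H0, Rmax_left by lra.
  unfold departure_from. rewrite Nat.ltb_irrefl, Nat.eqb_refl.
  split; [|assumption].
  unfold on_length, covered_length. simpl. rewrite !sum_n_n. split_ramp.
Qed.

(** The schedule is built backwards by prepending tasks. Fixing the first wake-up at [t] in the
    claim lets the preceding step compute the idle time it inserts. *)
Lemma gap_cost_attained (m p : nat) (t : R) :
  (p + m = n)%nat -> (1 <= p)%nat -> a p <= t -> t <= latest_start P a n p ->
  exists s : schedule,
    feasible P a p n s /\ (1 <= num_ap s)%nat /\ ap_start s 1 = t /\
    INR (num_ap s) * cost_wake P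
    + cost_idle P * (on_total s - INR (m + 1) * service_time P)
    = cost_wake P + gap_cost P a n m p t.
Proof.
  pose proof (service_time_pos P HP) as Hpos.
  revert p t. induction m as [|m IH]; intros p t Hpm Hp Hat Hts.
  all: assert (Ha0 : 0 <= a p) by
    (pose proof (arrivals_monotone N a 1 p Ha ltac:(lia) Hp ltac:(lia));
     destruct Ha; lra).
  all: assert (Hdl : t + service_time P <= deadline P a p) by
    (apply (le_latest_start P N) in Hts; try assumption; try lia;
     specialize (Hts p ltac:(lia)); rewrite Nat.sub_diag in Hts;
     simpl in Hts; lra).
  - replace p with n in * by lia.
    eexists. split; [now apply (feasible_last t)|].
    simpl. split; [lia|]. split; [reflexivity|].
    unfold on_total. simpl. rewrite sum_n_n. ring.
  - pose proof (next_le_latest_start p t ltac:(lia) Hts) as Hnext.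
    pose proof (arrival_le_latest_start (S p) ltac:(lia)) as Has.
    (* Extending the first period treats two cases at once: idling until [t' = a (S p)], and no gap,
       where [t'] is the departure of [p] and the idle term is zero. *)
    assert (earlier : forall t', Rmax (a (S p)) (t + service_time P) = t' ->
      a (S p) <= t' -> t' <= latest_start P a n (S p) ->
      exists s : schedule,
        feasible P a p n s /\ (1 <= num_ap s)%nat /\ ap_start s 1 = t /\
        INR (num_ap s) * cost_wake P
        + cost_idle P * (on_total s - INR (S m + 1) * service_time P)
        = cost_wake P + cost_idle P * (t' - (t + service_time P))
          + gap_cost P a n m (S p) t').
    { intros t' Hmax Hat' Hts'.
      destruct (IH (S p) t' ltac:(lia) ltac:(lia) Hat' Hts')
        as (s & Hs & Hnum & Hst & Hcost).
      exists (start_earlier p t s).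
      split; [apply feasible_start_earlier; try assumption; [lia|congruence]|].
      split; [assumption|]. split; [reflexivity|].
      unfold on_total in *.
      rewrite (sum_start_earlier (fun x y => y - x)) by assumption.
      rewrite Hst. simpl num_ap.
      replace (S m + 1)%nat with (S (m + 1)) by lia. rewrite S_INR. lra. }
    simpl gap_cost. destruct (Rle_dec (a (S p)) (t + service_time P)) as [Hle|Hgt].
    { destruct (earlier (t + service_time P)) as (s & Hs);
        [now apply Rmax_right|lra|lra|].
      exists s. intuition lra. }
    unfold Rmin at 1. destruct Rle_dec as [Hwake|Hidle].
    + destruct (IH (S p) (latest_start P a n (S p))) as
        (s & Hs & Hnum & Hst & Hcost); [lia|lia|lra|lra|].
      exists (wake_before p t s).
      split; [apply feasible_wake_before; try assumption; [lia|lra]|].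
      split; [simpl; lia|]. split; [reflexivity|].
      unfold on_total in *.
      rewrite (sum_wake_before (fun x y => y - x)).
      simpl num_ap. rewrite S_INR.
      replace (S m + 1)%nat with (S (m + 1)) by lia. rewrite S_INR. lra.
    + destruct (earlier (a (S p))) as (s & Hs);
        [apply Rmax_left; lra|lra|lra|].
      exists s. intuition lra.
Qed.

(** * The dynamic program *)

(** Skips the steps without a gap, matching the one-task steps of [gap_cost] with the jump to the
    first gap in [dp_value]. *)
Lemma gap_cost_contiguous (i m p : nat) (t : R) :
  (forall j : nat, (p < j <= p + i)%nat ->
     a j <= t + INR (j - p) * service_time P) ->
  gap_cost P a n (i + m) p t
  = gap_cost P a n m (p + i) (t + INR i * service_time P).
Proof.
  revert p t. induction i as [|i IH]; intros p t H;
    cbn [gap_cost Nat.add].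
  - simpl. rewrite Nat.add_0_r. f_equal. ring.
  - destruct Rle_dec as [Hle|Hgt].
    + rewrite IH.
      * rewrite S_INR. f_equal; [lia|ring].
      * intros j Hj. specialize (H j ltac:(lia)).
        replace (j - p)%nat with (S (j - S p)) in H by lia.
        rewrite S_INR in H. lra.
    + specialize (H (S p) ltac:(lia)).
      replace (S p - p)%nat with 1%nat in H by lia. simpl in H. lra.
Qed.

Lemma first_gap_Some (p l : nat) (t : R) :
  (p <= n)%nat -> first_gap P a n p t = Some l ->
  (p < l <= n)%nat /\ t + INR (l - p) * service_time P < a l /\
  (forall j : nat, (p <= j < l)%nat ->
     a j <= t + INR (j - p) * service_time P).
Proof.
  intros Hp H. apply find_some in H as [Hl H].
  apply in_seq in Hl. apply andb_prop in H as [H1 H2].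
  split; [lia|]. split; [now destruct Rlt_dec|].
  intros j Hj. rewrite forallb_forall in H2.
  specialize (H2 j). rewrite in_seq in H2. specialize (H2 ltac:(lia)).
  destruct Rge_dec; [lra|easy].
Qed.

(** By strong induction: the first task not yet arrived at its turn would satisfy the test and be
    returned by [find]. *)
Lemma first_gap_None (p : nat) (t : R) :
  a p <= t -> first_gap P a n p t = None ->
  forall j : nat, (p <= j <= n)%nat ->
    a j <= t + INR (j - p) * service_time P.
Proof.
  intros Hat H j. induction j as [j IH] using lt_wf_ind. intros Hj.
  destruct (Nat.eq_dec j p) as [->|Hne].
  { rewrite Nat.sub_diag. simpl. lra. }
  assert (Hin : In j (seq (p + 1) (n - p))) by (apply in_seq; lia).
  pose proof (find_none _ _ H j Hin) as Hnone. simpl in Hnone.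
  destruct Rlt_dec; [|lra].
  rewrite Bool.andb_true_l in Hnone. rewrite <- Bool.not_true_iff_false in Hnone.
  exfalso. apply Hnone, forallb_forall. intros i Hi. apply in_seq in Hi.
  specialize (IH i ltac:(lia) ltac:(lia)). destruct Rge_dec; [easy|lra].
Qed.

Definition table_correct (T : nat -> R * R) (p : nat) : Prop :=
  T p = (cost_wake P + INR (n - p + 1) * service_time P * cost_busy P
         + gap_cost P a n (n - p) p (latest_start P a n p),
         INR (n - p + 1) * service_time P * cost_busy P
         + gap_cost P a n (n - p) p (a p)).

Lemma dp_value_correct (T : nat -> R * R) (p : nat) (t c : R) :
  (1 <= p < n)%nat -> a p <= t ->
  (forall q : nat, (p < q <= n)%nat -> table_correct T q) ->
  dp_value P a n (fun q => fst (T q)) (fun q => snd (T q)) p t c =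
  c + INR (n - p + 1) * service_time P * cost_busy P
  + gap_cost P a n (n - p) p t.
Proof.
  intros Hp Hat HT. unfold dp_value.
  destruct (first_gap P a n p t) as [l|] eqn:Hgap.
  - apply first_gap_Some in Hgap as (Hl & Hlate & Hserved); [|lia].
    rewrite (HT l Hl). simpl fst. simpl snd.
    (* Tasks up to [l - 1] follow without a gap. The extra successor is the single step into [l],
       where [gap_cost] takes its minimum. *)
    replace (n - p)%nat with ((l - p - 1) + S (n - l))%nat at 2 by lia.
    rewrite gap_cost_contiguous by (intros j Hj; apply Hserved; lia).
    replace (n - p + 1)%nat with ((l - p) + (n - l + 1))%nat by lia.
    rewrite !plus_INR.
    simpl gap_cost. replace (S (p + (l - p - 1)))%nat with l by lia.
    replace (t + INR (l - p - 1) * service_time P + service_time P)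
      with (t + INR (l - p) * service_time P)
      by (replace (l - p)%nat with (S (l - p - 1)) by lia;
          rewrite S_INR; replace (S (l - p - 1) - 1)%nat with (l - p - 1)%nat by lia;
          ring).
    destruct Rle_dec; [lra|].
    unfold Rmin. repeat destruct Rle_dec; lra.
  - pose proof (first_gap_None p t Hat Hgap) as Hserved.
    replace (n - p)%nat with ((n - p) + 0)%nat at 3 by lia.
    rewrite gap_cost_contiguous by (intros j Hj; apply Hserved; lia).
    simpl. ring.
Qed.

(** The condition [m < n] keeps [n - m] positive, so the truncated subtractions indexing the table
    are exact. *)
Lemma dp_table_correct (m p : nat) :
  (m < n)%nat -> (n - m <= p <= n)%nat -> table_correct (dp_table P a n m) p.
Proof.
  revert p. induction m as [|m IH]; intros p Hm Hp.
  - unfold table_correct. simpl. replace p with n by lia.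
    rewrite Nat.sub_diag. simpl. f_equal; ring.
  - unfold table_correct. simpl. destruct (Nat.eqb_spec p (n - S m)) as [->|Hne].
    + assert (HT : forall q, (n - S m < q <= n)%nat ->
                table_correct (dp_table P a n m) q) by (intros; apply IH; lia).
      rewrite !(dp_value_correct (dp_table P a n m)); try assumption; try lia;
        try lra.
      * f_equal. ring.
      * apply arrival_le_latest_start. lia.
    + apply IH; lia.
Qed.

Lemma dp_S_eq (k : nat) :
  (1 <= k <= n)%nat ->
  dp_S P a n k = cost_wake P + INR (n - k + 1) * service_time P * cost_busy P
                 + gap_cost P a n (n - k) k (latest_start P a n k).
Proof.
  intros Hk. unfold dp_S. now rewrite dp_table_correct by lia.
Qed.

End Recursion.

Theorem theorem1 (P : system) (N : nat) (a : nat -> R) (k n : nat)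
    (hP : valid_system P)
    (ha : valid_arrivals N a)
    (harr : bounded_arrivals P N a)
    (hk : (1 <= k)%nat) (hkn : (k < n)%nat) (hn : (n <= N)%nat)
    (hsap : super_active_period P N a k n) :
  is_optimal_cost P a k n (dp_S P a n k).
Proof.
  rewrite (dp_S_eq P N a n) by (try assumption; lia).
  split.
  (* The optimal schedule wakes up at the latest punctual start of task [k], the same start as in
     the lower bound. *)
  - destruct (gap_cost_attained P N a n hP ha harr hn (n - k) k
                (latest_start P a n k)) as (s & Hs & _ & _ & Hcost);
      [lia|assumption| |apply Rle_refl|].
    + apply (arrival_le_latest_start P N); try assumption. lia.
    + exists s. split; [assumption|].
      rewrite (cost_eq P) by (try assumption; lia). lra.
  - intros s Hs.
    pose proof (cost_lower_bound P N a n hP ha harr hn k s hk Hs (n - k)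
                  ltac:(lia)). lra.
Qed.
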